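(* Let $A\in\mathbb R^{d\times m}$ be a full rank matrix with $d\geq m$, let $b\in\mathbb R^d$, and let $x^\ast\in\mathbb R^m$ be the solution to the linear system $Ax=b$. Let $\tau$ be a probability measure on the unit sphere $\mathbb S^{d-1}\subset\mathbb R^d$. Starting from any initial state $x_0\in\mathbb R^m$, the iterates $(x_k)_{k\geq0}$ of the generalized randomized Kaczmarz algorithm with direction distribution $\tau$ converge to $x^\ast$ in the sense that $$\sqrt{\mathbb E|x_k-x^\ast|^2}\ \leq\ (1-\rho)^k\,|x_0-x^\ast|\qquad\text{with rate}\qquad \rho\ =\ \frac12\inf_{|\zeta|=1}\mathbb E_{v\sim\tau}\Bigl(\zeta\cdot\frac{A^Tv}{|A^Tv|}\Bigr)^2,$$ where the infimum is over unit vectors $\zeta\in\mathbb R^m$.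
   Context: The generalized randomized Kaczmarz algorithm is defined as follows. For $v\in\mathbb S^{d-1}$ let $H(v)=\{x\in\mathbb R^m: v\cdot(Ax-b)=0\}$. In each iteration, sample a fresh $v\sim\tau$ and let $x_{k+1}$ be the orthogonal projection of $x_k$ onto $H(v)$, i.e. $$x_{k+1}=\Pi_{A^Tv}\,x_k+\frac{v\cdot b}{|A^Tv|}\,\frac{A^Tv}{|A^Tv|},\qquad \Pi_w=I_m-\frac{w\otimes w}{|w|^2},$$ where $w\otimes w=ww^T$ and $I_m$ is the identity matrix. $|\cdot|$ is the Euclidean norm and $\cdot$ the Euclidean inner product. *)

(* Defs.v *)
From mathcomp Require Import all_boot all_order all_algebra finmap.
From mathcomp Require Import all_classical all_reals all_analysis.

Set Implicit Arguments.
Unset Strict Implicit.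
Unset Printing Implicit Defensive.

Import Order.TTheory GRing.Theory Num.Theory.
Import numFieldNormedType.Exports.

Local Open Scope classical_set_scope.
Local Open Scope ring_scope.

(* The library norm on ['M[R]_(m, n)] is the max norm, hence these. *)
Definition dotv (R : realType) (n : nat) (u v : 'cV[R]_n) : R :=
  \sum_(i < n) u i 0 * v i 0.

Definition enorm (R : realType) (n : nat) (u : 'cV[R]_n) : R :=
  Num.sqrt (dotv u u).

Definition sphere (R : realType) (n : nat) : set 'cV[R]_n :=
  [set u | enorm u = 1].
Arguments sphere : clear implicits.

(* R^n with its Borel sigma-algebra. *)
Notation borelV R n := (g_sigma_algebraType (@open 'cV[R]_n)).

Definition mutually_independent (d d' : measure_display)
    (T : measurableType d) (T' : measurableType d') (R : realType)
    (P : probability T R) (I : choiceType) (X : I -> {mfun T >-> T'}) : Prop :=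
  forall (J : {fset I}) (B : I -> set T'),
    (forall i, i \in J -> measurable (B i)) ->
    P (\bigcap_(i in [set` J]) (X i @^-1` B i)) =
    (\prod_(i <- J) P (X i @^-1` B i))%E.

(* Measures are functions on all sets, so laws are compared only on the
   measurable ones. *)
Definition iid (d d' : measure_display)
    (T : measurableType d) (T' : measurableType d') (R : realType)
    (P : probability T R) (tau : probability T' R)
    (X : nat -> {mfun T >-> T'}) : Prop :=
  mutually_independent P X /\
  forall k (B : set T'), measurable B -> distribution P (X k) B = tau B.

(* Where [w = 0], [w / |w|] is [0] and [proj_orth w] is the identity. *)
Definition normalize (R : realType) (n : nat) (w : 'cV[R]_n) : 'cV[R]_n :=
  (enorm w)^-1 *: w.

Definition proj_orth (R : realType) (n : nat) (w : 'cV[R]_n) : 'M[R]_n :=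
  1%:M - (enorm w ^+ 2)^-1 *: (w *m w^T).

Definition hyperplane (R : realType) (d m : nat) (A : 'M[R]_(d, m))
    (b v : 'cV[R]_d) : set 'cV[R]_m :=
  [set x | dotv v (A *m x - b) = 0].

Definition kaczmarz_step (R : realType) (d m : nat) (A : 'M[R]_(d, m))
    (b : 'cV[R]_d) (x : 'cV[R]_m) (v : 'cV[R]_d) : 'cV[R]_m :=
  proj_orth (A^T *m v) *m x
  + (dotv v b / enorm (A^T *m v)) *: normalize (A^T *m v).

Fixpoint kaczmarz (R : realType) (d m : nat) (A : 'M[R]_(d, m))
    (b : 'cV[R]_d) (x0 : 'cV[R]_m) (v : nat -> 'cV[R]_d) (k : nat)
    : 'cV[R]_m :=
  if k is j.+1 then kaczmarz_step A b (kaczmarz A b x0 v j) (v j) else x0.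

Definition kaczmarz_rate (R : realType) (d m : nat) (A : 'M[R]_(d, m))
    (tau : probability (borelV R d) R) : R :=
  2^-1 * inf [set fine ('E_tau[fun v =>
                          dotv zeta (normalize (A^T *m v)) ^+ 2])
             | zeta in sphere R m].

Lemma dotvE (R : realType) (n : nat) (u v : 'cV[R]_n) :
  dotv u v = (u^T *m v) 0 0.
Proof. by rewrite mxE; apply: eq_bigr => i _; rewrite mxE. Qed.

Lemma dotvC (R : realType) (n : nat) (u v : 'cV[R]_n) : dotv u v = dotv v u.
Proof. by apply: eq_bigr => i _; rewrite mulrC. Qed.

Lemma dotvDr (R : realType) (n : nat) (u v w : 'cV[R]_n) :
  dotv u (v + w) = dotv u v + dotv u w.
Proof. by rewrite !dotvE mulmxDr mxE. Qed.

Lemma dotvZr (R : realType) (n : nat) a (u v : 'cV[R]_n) :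
  dotv u (a *: v) = a * dotv u v.
Proof. by rewrite !dotvE -scalemxAr mxE. Qed.

Lemma dotv_ge0 (R : realType) (n : nat) (u : 'cV[R]_n) : 0 <= dotv u u.
Proof. by apply: sumr_ge0 => i _; rewrite -expr2 sqr_ge0. Qed.

Lemma dotv_eq0 (R : realType) (n : nat) (u : 'cV[R]_n) :
  (dotv u u == 0) = (u == 0).
Proof.
apply/idP/eqP => [|->]; last first.
  by rewrite /dotv big1// => i _; rewrite mxE mul0r.
rewrite psumr_eq0 => [/allP h|i _]; last by rewrite -expr2 sqr_ge0.
apply/matrixP => i j; rewrite ord1 mxE.
by move: (h i (mem_index_enum i)); rewrite /= mulf_eq0 orbb => /eqP.
Qed.

Lemma kaczmarz_stepE (R : realType) (d m : nat) (A : 'M[R]_(d, m))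
    (b v : 'cV[R]_d) (x : 'cV[R]_m) (w := A^T *m v) :
  kaczmarz_step A b x v = x + ((dotv v b - dotv w x) / dotv w w) *: w.
Proof.
rewrite /kaczmarz_step -/w /proj_orth /normalize mulmxBl mul1mx.
rewrite -scalemxAl -mulmxA.
have -> : w *m (w^T *m x) = dotv w x *: w.
  rewrite dotvE; apply/matrixP => i j.
  by rewrite [LHS]mxE big_ord1 [RHS]mxE [j]ord1 mulrC.
rewrite !scalerA -mulrA -invfM -expr2 sqr_sqrtr ?dotv_ge0//.
by rewrite [_^-1 * _]mulrC mulrBl scalerBl addrA addrAC.
Qed.

(* The update is the orthogonal projection onto [H(v)] whenever the system is
   consistent; if [A^T v = 0] then [H(v)] is the whole space. *)
Lemma kaczmarz_step_proj (R : realType) (d m : nat) (A : 'M[R]_(d, m))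
    (b v : 'cV[R]_d) (x xstar : 'cV[R]_m) : A *m xstar = b ->
  hyperplane A b v (kaczmarz_step A b x v) /\
  forall y, hyperplane A b v y ->
    enorm (x - kaczmarz_step A b x v) <= enorm (x - y).
Proof.
move=> Ab; set w := A^T *m v; set p := kaczmarz_step A b x v.
have vA y : dotv v (A *m y) = dotv w y.
  by rewrite !dotvE /w trmx_mul trmxK mulmxA.
have HE y : hyperplane A b v y <-> dotv w y = dotv v b.
  rewrite /hyperplane /= dotvDr vA -scaleN1r dotvZr mulN1r.
  by split=> [/eqP|->]; rewrite ?subrr// subr_eq0 => /eqP.
have wp : dotv w p = dotv v b.
  rewrite /p kaczmarz_stepE -/w dotvDr dotvZr.
  have [w0|w0] := eqVneq w 0.
    have d0 y : dotv w y = 0 by rewrite w0 -[0](scale0r w) dotvC dotvZr mul0r.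
    by rewrite -Ab vA !d0 mulr0 addr0.
  by rewrite divfK ?dotv_eq0// addrC subrK.
split; first exact/HE.
move=> y /HE wy; apply: ler_wsqrtr.
set q := p - y; have wq : dotv w q = 0.
  by rewrite /q dotvDr -scaleN1r dotvZr wp wy mulN1r subrr.
set u := x - p; have qu : dotv q u = 0.
  rewrite /u /p kaczmarz_stepE -/w opprD addrA subrr add0r -scaleNr.
  by rewrite dotvZr [dotv q _]dotvC wq mulr0.
have -> : x - y = u + q by rewrite /u /q addrA subrK.
clearbody u q.
have -> : dotv (u + q) (u + q) = dotv u (u + q) + dotv q (u + q).
  by rewrite dotvC dotvDr (dotvC _ u) (dotvC _ q).
rewrite !dotvDr [dotv u q]dotvC qu.
by rewrite addr0 add0r lerDl dotv_ge0.
Qed.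

(* Main.v *)
From HB Require Import structures.
Require Import Defs.
From mathcomp Require Import all_boot all_order all_algebra finmap.
From mathcomp Require Import all_classical all_reals all_analysis.
From mathcomp Require Import measurable_realfun ring lra.

(* The error e_k = x_k - x* evolves by removing its component along
   n = A^T v / |A^T v|, so |e_(k+1)|^2 = |e_k|^2 - (e_k . n)^2.  As v_k is
   independent of e_k, integrating over v_k first gives
   E|e_(k+1)|^2 <= (1 - 2 rho) E|e_k|^2, and 1 - 2 rho <= (1 - rho)^2.  The
   integration over v_k is justified by an induction on k showing that e_k is
   independent of every event determined by finitely many of v_k, v_(k+1), ... *)

Set Implicit Arguments.
Unset Strict Implicit.
Unset Printing Implicit Defensive.

Import Order.TTheory GRing.Theory Num.Theory.
Import numFieldNormedType.Exports.

Local Open Scope classical_set_scope.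
Local Open Scope ring_scope.

(** * Independence in recursively defined processes *)

(** Rectangles are stable under intersection, generate the product sigma-algebra and include the
    whole space, so the pi-lambda argument applies. *)
Lemma finite_prod_measure_eq (d1 d2 : measure_display) (T1 : measurableType d1)
    (T2 : measurableType d2) (R : realType)
    (m1 m2 : {measure set (T1 * T2) -> \bar R}) :
  (m1 setT < +oo)%E ->
  (forall A B, measurable A -> measurable B -> m1 (A `*` B) = m2 (A `*` B)) ->
  forall X, measurable X -> m1 X = m2 X.
Proof.
move=> m1oo m12.
apply: (measure_unique [set A `*` B | A in measurable & B in measurable]
  (fun=> setT)).
- exact: measurable_prod_measurableType.
- move=> _ _ [A1 mA1 [B1 mB1 <-]] [A2 mA2 [B2 mB2 <-]].
  by rewrite -setXI; exists (A1 `&` A2); [exact: measurableI|];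
    exists (B1 `&` B2) => //; exact: measurableI.
- by move=> _; exists setT => //; exists setT => //; rewrite setXTT.
- by rewrite bigcup_const.
- by move=> _ [A mA [B mB <-]]; exact: m12.
- by [].
Qed.

(** These are exactly the future events on which mutual independence gives a product formula; an
    empty [J] gives the sure event. *)
Definition cylinder (d d' : measure_display) (T : measurableType d)
    (T' : measurableType d') (X : nat -> {mfun T >-> T'}) (k : nat)
    : set (set T) :=
  [set E | exists (J : {fset nat}) (B : nat -> set T'),
    (forall j, j \in J -> (k <= j)%N /\ measurable (B j)) /\
    E = \bigcap_(j in [set` J]) (X j @^-1` B j)].

Section recursive_process.
Context (d d1 d2 : measure_display) (T : measurableType d)
  (T1 : measurableType d1) (T2 : measurableType d2) (R : realType)
  (P : probability T R) (X : nat -> {mfun T >-> T2})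
  (F : T1 * T2 -> T1) (Y : nat -> T -> T1) (y0 : T1).
Hypotheses (mF : measurable_fun setT F) (indepX : mutually_independent P X)
  (Y0 : forall w, Y 0 w = y0) (YS : forall k w, Y k.+1 w = F (Y k w, X k w)).

Lemma measurable_process k : measurable_fun setT (Y k).
Proof.
elim: k => [|k IH].
  by rewrite (_ : Y 0 = cst y0)//; apply/funext.
rewrite (_ : Y k.+1 = F \o (fun w => (Y k w, X k w))); last exact/funext.
by apply: measurableT_comp => //; apply: measurable_fun_pair.
Qed.

Lemma measurable_cylinder k E : cylinder X k E -> measurable E.
Proof.
move=> [J [B [JB ->]]]; apply: fin_bigcap_measurable => // j /= jJ.
by have [_ mB] := JB _ jJ; rewrite -[X in measurable X]setTI; exact: measurable_funP.
Qed.

Lemma cylinder1 k (B : set T2) : measurable B -> cylinder X k (X k @^-1` B).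
Proof.
move=> mB; exists [fset k]%fset, (fun=> B); split.
  by move=> j; rewrite inE => /eqP ->.
by rewrite set_fset1 bigcap_set1.
Qed.

(** The indices of [E] all exceed [k], so a constraint on [X k] adds one new factor to the product
    given by mutual independence. *)
Lemma cylinderS k (B : set T2) E : measurable B -> cylinder X k.+1 E ->
  cylinder X k (X k @^-1` B `&` E) /\
  (P (X k @^-1` B `&` E) = P (X k @^-1` B) * P E)%E.
Proof.
move=> mB [J [C [JC ->]]].
have kJ : k \notin J by apply/negP => /JC[]; rewrite ltnn.
(* Since [k] is not in [J], the value of [C] at [k] is free and can be replaced by [B]. *)
pose D j := if j == k then B else C j.
have DC j : j \in J -> D j = C j.
  by rewrite /D; case: eqVneq => // -> /JC[]; rewrite ltnn.
have Dk : D k = B by rewrite /D eqxx.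
have DE : X k @^-1` B `&` \bigcap_(j in [set` J]) (X j @^-1` C j) =
    \bigcap_(j in [set` (k |` J)%fset]) (X j @^-1` D j).
  rewrite set_fsetU1 bigcap_setU1 Dk; congr (_ `&` _).
  by apply: eq_bigcapr => j /= jJ; rewrite DC.
have mD j : j \in (k |` J)%fset -> (k <= j)%N /\ measurable (D j).
  by rewrite in_fset1U => /orP[/eqP->|jJ]; [rewrite Dk|
    rewrite DC//; have [/ltnW] := JC _ jJ].
split; first by exists (k |` J)%fset, D.
rewrite DE !indepX//; [|by move=> j /JC[]|by move=> j /mD[]].
rewrite big_fsetU1//= Dk; congr (_ * _)%E.
by rewrite big_seq [RHS]big_seq; apply: eq_bigr => j jJ; rewrite DC.
Qed.

(* The two sides, as functions of the set of values of [(Y k, X k)], are finite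
   measures that agree on rectangles. *)
Lemma process_indep k (C : set T1) E : measurable C -> cylinder X k E ->
  (P (Y k @^-1` C `&` E) = P (Y k @^-1` C) * P E)%E.
Proof.
elim: k C E => [C E mC cE|k IH C E mC cE].
  have [Cy|Cy] := pselect (C y0).
    rewrite (_ : Y 0 @^-1` C = setT); first by rewrite setTI probability_setT mul1e.
    by apply/seteqP; split => w //= _; rewrite /preimage/= Y0.
  rewrite (_ : Y 0 @^-1` C = set0); first by rewrite set0I measure0 mul0e.
  by apply/seteqP; split => w //=; rewrite /preimage/= Y0.
have mE := measurable_cylinder cE.
pose Z w := (Y k w, X k w).
have mZ : measurable_fun setT Z.
  by apply: measurable_fun_pair => //; exact: measurable_process.
have PE0 : (0 <= fine (P E))%R by rewrite fine_ge0.
(* [pushforward P Z] is a measure only given [mZ], so [m1] and [m2] take it as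
   an argument. *)
pose m1 : measure _ R := pushforward (mrestr P mE) Z.
pose m2 : measure _ R := mscale (NngNum PE0) (pushforward P Z).
have PEE : ((fine (P E))%:E = P E)%E by rewrite fineK// fin_num_measure.
have m2E S : m2 mZ S = (P E * P (Z @^-1` S))%E by rewrite /m2/= /mscale/= PEE.
have mS : measurable (F @^-1` C) by rewrite -[X in measurable X]setTI; exact: mF.
have YE : Y k.+1 @^-1` C = Z @^-1` (F @^-1` C).
  by apply/seteqP; split => w /=; rewrite /preimage/= YS.
rewrite YE muleC -m2E.
apply: (@finite_prod_measure_eq _ _ _ _ _ (m1 mZ) (m2 mZ)) => //.
  rewrite /m1/= /pushforward/= /mrestr/=.
  apply: le_lt_trans (ltry 1); apply: probability_le1.
  by rewrite preimage_setT setTI.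
move=> A B mA mB; rewrite m2E.
have [cBE PBE] := cylinderS mB cE.
(* The induction hypothesis is used twice: forwards with the whole [k]-cylinder, then backwards with
   the constraint on [X k] alone. *)
transitivity (P (Y k @^-1` A `&` (X k @^-1` B `&` E))).
  by rewrite setIA.
rewrite IH// PBE muleA muleC; congr (_ * _)%E.
rewrite -IH//; exact: cylinder1.
Qed.

(** By independence the joint law of [Y k] and [X k] is the product of the law of [Y k] with [tau];
    Tonelli then integrates the second variable first. *)
Lemma process_step_integral (tau : probability T2 R) k (h : T1 * T2 -> \bar R) :
  (forall B, measurable B -> distribution P (X k) B = tau B) ->
  measurable_fun [set: T1 * T2] h -> (forall z, 0 <= h z)%E ->
  (\int[P]_w h (Y k w, X k w) = \int[P]_w \int[tau]_v h (Y k w, v))%E.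
Proof.
move=> Xtau mh h0; have mY := measurable_process k.
pose Z w := (Y k w, X k w).
have mZ : measurable_fun setT Z by apply: measurable_fun_pair.
pose Ym : {mfun T >-> T1} := HB.pack (Y k) (isMeasurableFun.Build _ _ _ _ _ mY).
pose PY : probability T1 R := distribution P Ym.
pose m' : measure _ R := pushforward P Z.
have mu_eq S : measurable S -> (PY \x tau)%E S = m' mZ S.
  apply: product_measure_unique => A B mA mB.
  transitivity (P (Y k @^-1` A `&` X k @^-1` B)); first by [].
  rewrite process_indep//; last exact: cylinder1.
  by congr (_ * _)%E; exact: Xtau.
transitivity (\int[m' mZ]_z h z)%E.
  by rewrite ge0_integral_pushforward.
rewrite -(@eq_measure_integral _ _ _ setT (m' mZ) (PY \x tau)%E); last first.
  by move=> S mS _; exact: mu_eq.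
rewrite fubini_tonelli1//.
rewrite ge0_integral_pushforward//.
  exact: measurable_fun_fubini_tonelli_F.
by move=> y _; apply: integral_ge0 => v _.
Qed.
End recursive_process.

(** * Orthogonal decomposition of the error *)

Section rejection.
Context (R : realType) (n : nat).
Implicit Types (w e : 'cV[R]_n).

(** The component of [e] orthogonal to [w]; for [w = 0] it is [e] itself. *)
Definition reject w e : 'cV[R]_n := e - (dotv w e / dotv w w) *: w.

Lemma sqr_enorm e : enorm e ^+ 2 = dotv e e.
Proof. by rewrite sqr_sqrtr// dotv_ge0. Qed.

Lemma dotv_normalize w e : dotv e (normalize w) ^+ 2 = dotv w e ^+ 2 / dotv w w.
Proof. by rewrite dotvZr exprMn exprVn sqr_enorm dotvC mulrC. Qed.

(** Pythagoras for the splitting of [e] along [w] and its orthogonal complement. For [w = 0] the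
    second term vanishes. *)
Lemma dotv_reject w e :
  dotv (reject w e) (reject w e) + dotv e (normalize w) ^+ 2 = dotv e e.
Proof.
rewrite dotv_normalize /reject -scaleNr.
set c := - _; have dDl u v z : dotv (u + v) z = dotv u z + dotv v z :> R.
  by rewrite dotvC dotvDr !(dotvC z).
rewrite dDl !dotvDr !dotvZr !(dotvC (c *: w)) !dotvZr (dotvC e w) /c.
have [/eqP|w0] := eqVneq (dotv w w) 0; last by field.
rewrite dotv_eq0 => /eqP ->.
have d0 u : dotv 0 u = 0 :> R by rewrite -[0](scale0r u) dotvC dotvZr mul0r.
by rewrite !d0; ring.
Qed.

Lemma dotv_normalize_le w e : dotv e (normalize w) ^+ 2 <= dotv e e.
Proof. by rewrite -(dotv_reject w e) lerDr dotv_ge0. Qed.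

End rejection.

(** * Measurability of the operations in one step *)

(** Inversion is continuous off 0, so the line is split into the point 0 and its open complement. *)
Lemma measurable_inv (R : realType) : measurable_fun setT (@GRing.inv R).
Proof.
have -> : [set: R] = [set 0] `|` [set x | x != 0].
  by apply/seteqP; split => // x _; have [->|] := eqVneq x 0; [left|right].
apply/measurable_funU => //; first by apply: open_measurable; exact: open_neq.
split; first exact: measurable_fun_set1.
apply: open_continuous_measurable_fun; first exact: open_neq.
by move=> x; rewrite inE; exact: inv_continuous.
Qed.

Lemma measurable_borelV_coord (R : realType) (d : nat) (i : 'I_d) :
  measurable_fun setT (fun v : borelV R d => v i 0).
Proof.
apply: (measurability _ (RGenOpens.measurableE R)).
move=> _ [_ [a [b ->] <-]]; rewrite setTI; apply: sub_sigma_algebra.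
have /continuousP := @coord_continuous R d 1 i 0.
by apply; exact: interval_open.
Qed.

Section coordinatewise_measurability.
Context (d : measure_display) (T : measurableType d) (R : realType).

(** This form asks for no sigma-algebra on the vectors and reduces every check to sums, products and
    inverses of real functions. *)
Definition col_measurable n (f : T -> 'cV[R]_n) : Prop :=
  forall i, measurable_fun setT (fun x => f x i 0).

Lemma col_measurable_dotv n (f g : T -> 'cV[R]_n) :
  col_measurable f -> col_measurable g ->
  measurable_fun setT (fun x => dotv (f x) (g x)).
Proof. by move=> mf mg; apply: measurable_sum => i; exact: measurable_funM. Qed.

Lemma col_measurable_mulmx m n (B : 'M[R]_(m, n)) (f : T -> 'cV[R]_n) :
  col_measurable f -> col_measurable (fun x => B *m f x).
Proof.
move=> mf i; under eq_fun do rewrite mxE.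
by apply: measurable_sum => j; exact: measurable_funM.
Qed.

Lemma col_measurable_reject n (f g : T -> 'cV[R]_n) :
  col_measurable f -> col_measurable g ->
  col_measurable (fun x => reject (f x) (g x)).
Proof.
move=> mf mg i; under eq_fun do rewrite /reject !mxE.
apply: measurable_funB => //; apply: measurable_funM => //.
apply: measurable_funM; first exact: col_measurable_dotv.
by apply: (measurableT_comp (@measurable_inv R)); exact: col_measurable_dotv.
Qed.
End coordinatewise_measurability.

Lemma probability_integral_cst (d : measure_display) (T : measurableType d)
    (R : realType) (P : probability T R) (c : R) : (\int[P]_x c%:E = c%:E)%E.
Proof. by rewrite integral_cst//= probability_setT mule1. Qed.

(** * One-step contraction in mean square *)

Section rate.
Context (R : realType) (d m : nat) (A : 'M[R]_(d, m))
  (tau : probability (borelV R d) R).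

Let sqcos (e : 'cV[R]_m) (v : borelV R d) : R :=
  dotv e (normalize (A^T *m v)) ^+ 2.

Lemma col_measurable_trmulmx : col_measurable (fun v : borelV R d => A^T *m v).
Proof. by apply: col_measurable_mulmx => i; exact: measurable_borelV_coord. Qed.

Lemma measurable_sqcos e : measurable_fun setT (EFin \o sqcos e).
Proof.
apply/measurable_EFinP.
(* This form has no square root: only dot products, a power and an inverse remain. *)
rewrite (_ : sqcos e = fun v => dotv (A^T *m v) e ^+ 2 / dotv (A^T *m v) (A^T *m v)).
  have mw := col_measurable_trmulmx.
  apply: measurable_funM.
    by apply: measurable_funX; apply: col_measurable_dotv => // i; exact: measurable_cst.
  by apply: (measurableT_comp (@measurable_inv R)); exact: col_measurable_dotv.
by apply/funext => v; exact: dotv_normalize.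
Qed.

Lemma integral_sqcos_le e : (\int[tau]_v (sqcos e v)%:E <= (dotv e e)%:E)%E.
Proof.
rewrite -(probability_integral_cst tau).
apply: ge0_le_integral => //.
- by move=> v _; rewrite lee_fin sqr_ge0.
- exact: measurable_sqcos.
- by move=> v _; rewrite lee_fin dotv_normalize_le.
Qed.

Lemma integral_sqcos_fin e : (\int[tau]_v (sqcos e v)%:E)%E \is a fin_num.
Proof.
rewrite ge0_fin_numE; first exact: le_lt_trans (integral_sqcos_le e) (ltry _).
by apply: integral_ge0 => v _; rewrite lee_fin sqr_ge0.
Qed.

(** Both sides are quadratic in [e], so the infimum over unit vectors is tested at [e] divided by
    its norm; the 2 cancels the one half in the rate. *)
Lemma kaczmarz_rate_lb e :
  2 * kaczmarz_rate A tau * dotv e e <= fine (\int[tau]_v (sqcos e v)%:E).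
Proof.
have [->|e0] := eqVneq e 0.
  have -> : dotv (0 : 'cV[R]_m) 0 = 0 by apply/eqP; rewrite dotv_eq0 eqxx.
  by rewrite mulr0 fine_ge0//; apply: integral_ge0 => v _; rewrite lee_fin sqr_ge0.
have ee_gt0 : 0 < dotv e e by rewrite lt_neqAle eq_sym dotv_eq0 e0 dotv_ge0.
have e_gt0 : 0 < enorm e by rewrite sqrtr_gt0.
rewrite -ler_pdivlMr// /kaczmarz_rate mulrA divff ?mul1r ?pnatr_eq0//.
set S := [set _ | _ in _].
(* A real [inf] bounds its set from below only if some lower bound exists; here 0 serves, as the
   integrands are squares. *)
have Slb : has_lbound S.
  exists 0 => _ [z _ <-]; rewrite fine_ge0// unlock.
  by apply: integral_ge0 => v _; rewrite lee_fin sqr_ge0.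
apply: (ge_inf Slb); exists ((enorm e)^-1 *: e).
  rewrite /sphere/= {1}/enorm dotvZr dotvC dotvZr mulrA -expr2 exprVn sqr_enorm.
  by rewrite mulVf ?sqrtr1// gt_eqF.
rewrite unlock.
under eq_integral => v _.
  rewrite dotvC dotvZr exprMn exprVn sqr_enorm (dotvC _ e) EFinM.
  over.
rewrite ge0_integralZl//; first by rewrite fineM ?integral_sqcos_fin//= mulrC.
- exact: measurable_sqcos.
- by move=> v _; rewrite lee_fin sqr_ge0.
- by rewrite lee_fin invr_ge0 ltW.
Qed.

(** Makes the contraction factor [1 - 2 * rho] nonnegative, so that it can be iterated and its
    powers compared. *)
Lemma kaczmarz_rate_le : 2 * kaczmarz_rate A tau <= 1.
Proof.
(* The sphere is empty when [m = 0]; the infimum of the empty set is then 0. *)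
have [[z sz]|/set0P/negP/negPn/eqP S0] := pselect (sphere R m !=set0); last first.
  by rewrite /kaczmarz_rate S0 image_set0 inf0 !mulr0.
have zz : dotv z z = 1 by rewrite -sqr_enorm sz expr1n.
have := kaczmarz_rate_lb z; rewrite zz mulr1 => /le_trans; apply.
by rewrite -lee_fin fineK ?integral_sqcos_fin// -zz integral_sqcos_le.
Qed.

(** Integrate the Pythagorean identity [dotv_reject] over [tau] and bound the removed part from
    below by [kaczmarz_rate_lb]. *)
Lemma integral_reject_le e :
  (\int[tau]_v (dotv (reject (A^T *m v) e) (reject (A^T *m v) e))%:E
   <= ((1 - 2 * kaczmarz_rate A tau) * dotv e e)%:E)%E.
Proof.
have mr : measurable_fun setT
    (fun v : borelV R d => dotv (reject (A^T *m v) e) (reject (A^T *m v) e)).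
  have mw : col_measurable (fun v : borelV R d => reject (A^T *m v) e).
    by apply: col_measurable_reject; [exact: col_measurable_trmulmx|]
      => i; exact: measurable_cst.
  exact: col_measurable_dotv.
rewrite mulrBl mul1r EFinB leeBrDr//.
apply: (@le_trans _ _ (\int[tau]_v (dotv (reject (A^T *m v) e) (reject (A^T *m v) e))%:E
    + \int[tau]_v (sqcos e v)%:E)%E).
  by apply: leeD2l; rewrite -[leRHS]fineK ?integral_sqcos_fin// lee_fin kaczmarz_rate_lb.
rewrite -ge0_integralD//.
- under eq_integral do rewrite -EFinD dotv_reject.
  by rewrite probability_integral_cst.
- by move=> v _; rewrite lee_fin dotv_ge0.
- exact/measurable_EFinP.
- by move=> v _; rewrite lee_fin sqr_ge0.
- exact: measurable_sqcos.
Qed.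

End rate.

(** * Error recursion and the convergence bound *)

(* The error process lives in [m.-tuple R], whose sigma-algebra is generated by
   the coordinates: measurability into it can be checked coordinatewise. *)
Definition col_of_tuple (R : realType) (m : nat) (t : m.-tuple R) : 'cV[R]_m :=
  \col_i tnth t i.

Definition tuple_of_col (R : realType) (m : nat) (e : 'cV[R]_m) : m.-tuple R :=
  [tuple e i 0 | i < m].

Lemma tuple_of_colK (R : realType) (m : nat) :
  cancel (@tuple_of_col R m) (@col_of_tuple R m).
Proof. by move=> e; apply/matrixP => i j; rewrite ord1 mxE tnth_mktuple. Qed.

(** Consistency turns [dotv v b] into [dotv (A^T *m v) xstar], so the affine step acts linearly on
    the error. *)
Lemma kaczmarz_error (R : realType) (d m : nat) (A : 'M[R]_(d, m))
    (b v : 'cV[R]_d) (x xstar : 'cV[R]_m) : A *m xstar = b ->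
  kaczmarz_step A b x v - xstar = reject (A^T *m v) (x - xstar).
Proof.
move=> <-; rewrite kaczmarz_stepE /reject.
have -> : dotv v (A *m xstar) = dotv (A^T *m v) xstar.
  by rewrite !dotvE trmx_mul trmxK mulmxA.
have -> : dotv (A^T *m v) (x - xstar) = dotv (A^T *m v) x - dotv (A^T *m v) xstar.
  by rewrite dotvDr -scaleN1r dotvZr mulN1r.
by rewrite addrAC -scaleNr -mulNr opprB.
Qed.

Theorem lemma6 (R : realType) (d m : nat) (A : 'M[R]_(d, m))
    (b : 'cV[R]_d) (xstar : 'cV[R]_m)
    (hdm : (m <= d)%N) (hA : \rank A = minn d m) (hx : A *m xstar = b)
    (tau : probability (borelV R d) R) (htau : tau (sphere R d) = 1%E)
    (disp : measure_display) (Omega : measurableType disp)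
    (P : probability Omega R) (V : nat -> {mfun Omega >-> borelV R d})
    (hV : iid P tau V) (x0 : 'cV[R]_m) (k : nat) :
  (sqrte 'E_P[fun omega : Omega =>
     (enorm (kaczmarz A b x0 (fun j => V j omega) k - xstar) ^+ 2)%R]
   <= ((1 - kaczmarz_rate A tau) ^+ k * enorm (x0 - xstar))%:E)%E.
Proof.
have [Vindep Vtau] := hV.
pose err j w := kaczmarz A b x0 (fun i => V i w) j - xstar.
have errS j w : err j.+1 w = reject (A^T *m V j w) (err j w).
  exact: kaczmarz_error.
pose F (z : m.-tuple R * borelV R d) : m.-tuple R :=
  tuple_of_col (reject (A^T *m z.2) (col_of_tuple z.1)).
have mrej : col_measurable (fun z : m.-tuple R * borelV R d =>
    reject (A^T *m z.2) (col_of_tuple z.1)).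
  apply: col_measurable_reject.
    apply: col_measurable_mulmx => i.
    exact: (measurableT_comp (measurable_borelV_coord i) measurable_snd).
  move=> i; under eq_fun do rewrite mxE.
  exact: (measurableT_comp (measurable_tnth i) measurable_fst).
have mF : measurable_fun setT F.
  apply/measurable_fun_tnthP => i.
  rewrite (_ : _ \o _ = fun z => reject (A^T *m z.2) (col_of_tuple z.1) i 0)//.
  by apply/funext => z /=; rewrite tnth_mktuple.
pose Y j w := tuple_of_col (err j w).
have Y0 w : Y 0 w = tuple_of_col (x0 - xstar) by [].
have YS j w : Y j.+1 w = F (Y j w, V j w).
  by rewrite /Y /F/= tuple_of_colK errS.
set rho := kaczmarz_rate A tau.
have rho_le : 2 * rho <= 1 := kaczmarz_rate_le A tau.
pose h (z : m.-tuple R * borelV R d) : \bar R :=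
  (dotv (reject (A^T *m z.2) (col_of_tuple z.1))
        (reject (A^T *m z.2) (col_of_tuple z.1)))%:E.
have mh : measurable_fun setT h by apply/measurable_EFinP; exact: col_measurable_dotv.
have h0 z : (0 <= h z)%E by rewrite lee_fin dotv_ge0.
have mG : measurable_fun setT (fun t => \int[tau]_v h (t, v))%E.
  exact: measurable_fun_fubini_tonelli_F.
have merr j : col_measurable (err j).
  move=> i; rewrite (_ : (fun _ => _) = fun w => tnth (Y j w) i).
    exact: (measurableT_comp (measurable_tnth i) (measurable_process mF Y0 YS j)).
  by apply/funext => w; rewrite tnth_mktuple.
have E_le : (\int[P]_w (dotv (err k w) (err k w))%:E
    <= ((1 - 2 * rho) ^+ k * dotv (x0 - xstar) (x0 - xstar))%:E)%E.
  elim: k => [|j IH].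
    by rewrite expr0 mul1r /err/= probability_integral_cst.
  (* The integrand is put in the form [h (Y j w, V j w)], so that the fresh direction can be
     integrated out for fixed [Y j w]. *)
  under eq_integral => w _ do
    rewrite errS -[in X in dotv X _](tuple_of_colK (err j w))
      -[in X in dotv _ X](tuple_of_colK (err j w)) -/(h (Y j w, V j w)).
  rewrite (process_step_integral mF Vindep Y0 YS (Vtau j) mh h0).
  apply: (@le_trans _ _ (\int[P]_w ((1 - 2 * rho)%:E * (dotv (err j w) (err j w))%:E))%E).
    apply: ge0_le_integral => //.
    - by move=> w _; apply: integral_ge0.
    - exact: (measurableT_comp mG (measurable_process mF Y0 YS j)).
    - by apply/measurable_EFinP; apply: measurable_funM => //; exact: col_measurable_dotv.
    - by move=> w _; rewrite /h/= tuple_of_colK -EFinM; exact: integral_reject_le.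
  rewrite ge0_integralZl//; last 3 first.
  - by apply/measurable_EFinP; exact: col_measurable_dotv.
  - by move=> w _; rewrite lee_fin dotv_ge0.
  - by rewrite lee_fin subr_ge0.
  by rewrite exprS -mulrA EFinM lee_wpmul2l// lee_fin subr_ge0.
have bound_ge0 : 0 <= (1 - rho) ^+ k * enorm (x0 - xstar).
  by rewrite mulr_ge0 ?sqrtr_ge0// exprn_ge0//; lra.
(* The nonnegative bound is the root of its square, so it suffices to compare squares. *)
rewrite -[leRHS]gee0_abs ?lee_fin// -sqrte_sqr lee_sqrt ?expe_ge0 ?lee_fin//.
rewrite unlock; under eq_integral do rewrite sqr_enorm.
apply: le_trans E_le _.
rewrite -EFin_expe lee_fin exprMn sqr_enorm ler_wpM2r ?dotv_ge0//.
(* With [(1 - rho) ^+ (2 * k)] read as a [k]-th power, the bases differ by [rho ^+ 2], and powers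
   are monotone on nonnegative bases. *)
rewrite -exprM mulnC exprM lerXn2r ?nnegrE ?sqr_ge0 ?subr_ge0//.
by have := sqr_ge0 rho; lra.
Qed.
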